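(* Let $A$ be a factorization domain and $E$ an $A$-module such that $\operatorname{Irr}(A)\subseteq W(E)^{\#}$. Then $\operatorname{EC}(\operatorname{Irr}(W(E)^{\#}))$ is dense in $qD_A(E)$.
   Context: A factorization domain is an integral domain in which every nonzero nonunit is a finite product of irreducible elements. $\operatorname{Irr}(A)$ is the set of irreducible elements of $A$. For an $A$-module $E$: $\operatorname{ann}(E)=\{a\in A: aE=0\}$, $W(E)=\{a\in A: aE\neq E\}$, $W(E)^{\#}=W(E)\setminus\operatorname{ann}(E)$. On $W(E)^{\#}$ put $a\sim b$ iff $aE=bE$; $[a]$ is the class of $a$ and $\operatorname{EC}(W(E)^{\#})$ is the set of all classes. For $a\in W(E)^{\#}$, $U_a=\{[b]\in\operatorname{EC}(W(E)^{\#}): aE\subseteq bE\}$. The quasi divisor topology $qD_A(E)$ is the topological space $\operatorname{EC}(W(E)^{\#})$ whose topology has basis $\{U_a\}_{a\in W(E)^{\#}}$. $\operatorname{Irr}(W(E)^{\#})$ is the set of elements of $W(E)^{\#}$ that are irreducible in $A$, and $\operatorname{EC}(\operatorname{Irr}(W(E)^{\#}))=\{[r]: r\in\operatorname{Irr}(W(E)^{\#})\}$. *)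

(* Defs.v *)
From HB Require Import structures.
From mathcomp Require Import all_boot all_order all_algebra.
From mathcomp Require Import boolp classical_sets topology.

Set Implicit Arguments.
Unset Strict Implicit.
Unset Printing Implicit Defensive.

Import GRing.Theory.

Local Open Scope quotient_scope.
Local Open Scope classical_set_scope.
Local Open Scope ring_scope.

Definition Irr (A : idomainType) : set A :=
  [set r | [/\ r != 0, r \isn't a GRing.unit
    & forall x y : A, r = x * y -> x \is a GRing.unit \/ y \is a GRing.unit]].
Arguments Irr A : clear implicits.

Definition factorization_domain (A : idomainType) : Prop :=
  forall a : A, a != 0 -> a \isn't a GRing.unit ->
    exists2 s : seq A, {in s, forall r, Irr A r} & a = \prod_(r <- s) r.

Definition scaled (A : idomainType) (E : lmodType A) (a : A) : set E :=
  [set a *: x | x in [set: E]].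
Arguments scaled {A} E a.

Definition ann (A : idomainType) (E : lmodType A) : set A :=
  [set a | scaled E a = [set 0]].
Arguments ann {A} E.

Definition W (A : idomainType) (E : lmodType A) : set A :=
  [set a | scaled E a <> [set: E]].
Arguments W {A} E.

Definition Wsharp (A : idomainType) (E : lmodType A) : set A :=
  W E `\` ann E.
Arguments Wsharp {A} E.

Definition Wequiv (A : idomainType) (E : lmodType A) : rel (Wsharp E) :=
  fun a b => `[< scaled E (val a) = scaled E (val b) >].

Lemma Wequiv_refl (A : idomainType) (E : lmodType A) : reflexive (@Wequiv A E).
Proof. by move=> a; apply/asboolP. Qed.

Lemma Wequiv_sym (A : idomainType) (E : lmodType A) : symmetric (@Wequiv A E).
Proof. by move=> a b; apply/asboolP/asboolP => ->. Qed.

Lemma Wequiv_trans (A : idomainType) (E : lmodType A) :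
  transitive (@Wequiv A E).
Proof.
by move=> b a c /asboolP ab /asboolP bc; apply/asboolP; rewrite ab.
Qed.

Canonical Wequiv_equiv (A : idomainType) (E : lmodType A) :=
  EquivRel (@Wequiv A E) (@Wequiv_refl A E) (@Wequiv_sym A E)
    (@Wequiv_trans A E).

(* EC(W(E)^#), as a quotient of the subtype W(E)^#; {eq_quot _} carries no
   topology of its own here: the one generated by the sets U a is put on it
   below. *)
Definition qD (A : idomainType) (E : lmodType A) : Type :=
  {eq_quot @Wequiv A E}.

HB.instance Definition _ (A : idomainType) (E : lmodType A) :=
  Choice.on (qD E).

Definition cls (A : idomainType) (E : lmodType A) (a : Wsharp E) : qD E :=
  \pi_({eq_quot @Wequiv A E}) a.

Definition U (A : idomainType) (E : lmodType A) (a : Wsharp E) : set (qD E) :=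
  [set cls b | b in [set b : Wsharp E |
                      scaled E (val a) `<=` scaled E (val b)]].

Lemma cls_eq (A : idomainType) (E : lmodType A) (a b : Wsharp E) :
  cls a = cls b <-> scaled E (val a) = scaled E (val b).
Proof.
by split=> [/eqquotP/asboolP //|ab]; apply/eqquotP/asboolP.
Qed.

Definition U_basis (A : idomainType) (E : lmodType A) : set (set (qD E)) :=
  [set U a | a in [set: Wsharp E]].
Arguments U_basis {A} E.

Lemma U_cover (A : idomainType) (E : lmodType A) :
  \bigcup_(V in U_basis E) V = [set: qD E].
Proof.
apply/seteqP; split=> // t _; exists (U (repr t)); first by exists (repr t).
by exists (repr t) => //; rewrite /cls reprK.
Qed.

Lemma U_join (A : idomainType) (E : lmodType A) (V1 V2 : set (qD E)) (t : qD E) :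
  U_basis E V1 -> U_basis E V2 -> V1 t -> V2 t ->
  exists V, [/\ U_basis E V, V t & V `<=` V1 `&` V2].
Proof.
move=> [a _ <-] [b _ <-] [c /= ac <-] [d /= bd /cls_eq dc].
exists (U c); split; [by exists c | by exists c |].
move=> _ [e /= ce <-]; split; exists e => //=.
  exact: subset_trans ac ce.
by apply: subset_trans ce; rewrite -dc.
Qed.

HB.instance Definition _ (A : idomainType) (E : lmodType A) :=
  @isBaseTopological.Build (qD E) (set (qD E)) (U_basis E) id
    (@U_cover A E) (@U_join A E).

Definition EC_Irr (A : idomainType) (E : lmodType A) : set (qD E) :=
  [set cls r | r in [set r : Wsharp E | Irr A (val r)]].
Arguments EC_Irr {A} E.

(* Main.v *)
Require Import Defs.
From mathcomp Require Import all_boot all_order all_algebra.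
From mathcomp Require Import boolp classical_sets topology.

(** Every nonempty open set contains a nonempty basic set [U a].  An element
    [a] of [Wsharp E] is neither zero (zero annihilates [E]) nor a unit (a unit
    maps [E] onto itself), so it has an irreducible factor [r]
    ([irreducible_factor]).  By hypothesis [r] lies in [Wsharp E], and
    [a E] is contained in [r E] because [r] divides [a] ([scaled_mul_sub]);
    hence the class of [r] belongs to [U a]. *)

Local Open Scope classical_set_scope.
Local Open Scope ring_scope.

Import GRing.Theory.

Lemma scaled_mul_sub (A : idomainType) (E : lmodType A) (a b : A) :
  scaled E (a * b) `<=` scaled E a.
Proof. by move=> _ [x _ <-]; exists (b *: x); rewrite ?scalerA. Qed.

Lemma Wsharp_neq0 (A : idomainType) (E : lmodType A) (a : A) :
  Wsharp E a -> a != 0.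
Proof.
move=> [_ annNa]; apply/eqP => a0; apply: annNa.
rewrite /ann /= a0; apply/seteqP; split=> [_ [x _ <-]|_ ->].
  by rewrite scale0r.
by exists 0; rewrite ?scale0r.
Qed.

Lemma Wsharp_nonunit (A : idomainType) (E : lmodType A) (a : A) :
  Wsharp E a -> a \isn't a GRing.unit.
Proof.
move=> [aE_neq _]; apply/negP => a_unit; apply: aE_neq.
apply/seteqP; split=> // x _; exists (a^-1 *: x) => //.
by rewrite scalerA divrr // scale1r.
Qed.

Lemma irreducible_factor (A : idomainType) (a : A) :
  factorization_domain A -> a != 0 -> a \isn't a GRing.unit ->
  exists r b : A, Irr A r /\ a = r * b.
Proof.
move=> facA a_neq0 a_nonunit.
have [[|r s] s_irr a_prod] := facA a a_neq0 a_nonunit.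
  (* The empty product is 1, a unit. *)
  by move: a_nonunit; rewrite a_prod big_nil unitr1.
exists r, (\prod_(q <- s) q); split; last by rewrite a_prod big_cons.
by apply: s_irr; rewrite mem_head.
Qed.

Theorem theorem3 (A : idomainType) (E : lmodType A)
    (hA : factorization_domain A)
    (hE : Irr A `<=` Wsharp E) :
  dense (EC_Irr E).
Proof.
(* The basis of the topology is indexed by itself: an open set is the union of
   a subfamily of [U_basis E]. *)
move=> O [t Ot] [D D_basis O_eq].
move: Ot; rewrite -O_eq => -[V DV _].
have [a _ Ua_eq] := D_basis _ DV.
have aW : Wsharp E (val a) := set_mem (valP a).
have [r [b [r_irr a_eq]]] :=
  irreducible_factor A (val a) hA (Wsharp_neq0 A E _ aW) (Wsharp_nonunit A E _ aW).
pose r' : Wsharp E := SigSub (mem_set (hE r r_irr)).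
exists (cls r'); split; last by exists r'.
exists V => //=; rewrite -Ua_eq; exists r' => //=.
by rewrite a_eq; apply: scaled_mul_sub.
Qed.
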